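(* Let $\mathcal{A}$ be a family of functions, each $g\in\mathcal{A}$ a function $g:\mathbf{No}^{m_g}\to\mathbf{No}$, such that for every initial $T\subseteq\mathbf{No}$ the closure $\mathrm{cl}_{\mathcal{A}}(T)$ is initial. Let $f:\mathbf{No}^n\to\mathbf{No}$ be recursive over $\mathcal{A}$, and let $S$ be an initial subclass of $\mathbf{No}$. Then $\mathrm{cl}_{\mathcal{A}\cup\{f\}}(S)$ is initial.
   Context: $\mathbf{No}$ is the class of surreal numbers (sign sequences $x:\alpha\to\{+,-\}$, $\alpha$ an ordinal) with its usual order $<$; $y\prec x$ means $y$ is a proper initial segment (restriction to a smaller ordinal) of $x$, and $y\preceq x$ means $y\prec x$ or $y=x$. For sets $L<R$, $\{L\mid R\}$ is the simplest ($\preceq$-least) $x$ with $L<x<R$. A subclass $S$ is initial iff $x\in S$ and $y\preceq x$ imply $y\in S$. For a family $\mathcal{B}$ of functions $g:\mathbf{No}^{m_g}\to\mathbf{No}$, a class $T$ is closed under $\mathcal{B}$ iff $g(T^{m_g})\subseteq T$ for every $g\in\mathcal{B}$, and $\mathrm{cl}_{\mathcal{B}}(S)$ is the smallest class containing $S$ and closed under $\mathcal{B}$. Recursive functions of $n$ variables: on $\mathbf{No}^n$, $\vec y\preceq\vec x$ iff $y_i\preceq x_i$ for all $i$. Let $K=\{+,-,0\}^n\setminus\{(0,\dots,0)\}$, $k=3^n-1$, with a fixed enumeration $\sigma(1),\dots,\sigma(k)$. For $\sigma\in K$, $\vec y$ is a $\sigma$-option of $\vec x$ iff $\vec y\prec\vec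 x$ and for each $i$: $y_i<x_i$ iff $\sigma_i=-$, $y_i>x_i$ iff $\sigma_i=+$, $y_i=x_i$ iff $\sigma_i=0$. Given sets $L,R$ of functions (options), $f=\{L\mid R\}$ means that for all $\vec x$, $f(\vec x)=\{\,g(\vec x,\vec x^{\sigma(1)},\dots,\vec x^{\sigma(k)},f(\vec x^{\sigma(1)}),\dots,f(\vec x^{\sigma(k)})): g\in L \mid \text{same with } g\in R\,\}$, where each $\vec x^{\sigma(i)}$ ranges over the $\sigma(i)$-options of $\vec x$ (options may ignore some arguments). $f$ is recursive over $\mathcal{A}$ if such $L,R\subseteq\mathcal{A}$ exist. *)

(* Defs.v *)
From mathcomp Require Import all_boot boolp classical_sets.

Set Implicit Arguments.
Unset Strict Implicit.
Unset Printing Implicit Defensive.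

Local Open Scope classical_set_scope.

(* Sets versus proper classes: a set is a collection indexed by a type of one
   fixed universe [smallType].  [ord] and [No] below live strictly above that
   universe, and predicates on them ([set No]) play the role of classes. *)
Definition smallType := Type.

Definition is_small (X : Type) (C : set X) : Prop :=
  exists (I : smallType) (h : I -> X), C = range h.

(* [osup a] denotes the least ordinal strictly above all the [a i].  Distinct
   trees may denote the same ordinal: equality of ordinals is [ole] in both
   directions. *)
Inductive ord := osup (I : smallType) (a : I -> ord).

Fixpoint ole (a b : ord) {struct a} : Prop :=
  match a, b with
  | osup _ f, osup _ g => forall i, exists j, ole (f i) (g j)
  end.

Definition olt (a b : ord) : Prop :=
  match b with osup _ g => exists j, ole a (g j) end.

Inductive sign := Minus | Zero | Plus.

Definition sign_lt (s t : sign) : Prop :=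
  match s, t with
  | Minus, Zero | Minus, Plus | Zero, Plus => True
  | _, _ => False
  end.

(* A sign sequence alpha -> {+,-} is extended by [Zero] on all ordinals >= alpha;
   thus [sgn x b <> Zero] means that b is in the domain of x. *)
Record No := MkNo {
  sgn :> ord -> sign;
  sgn_ext : forall a b, ole a b -> ole b a -> sgn a = sgn b;
  sgn_dom : exists alpha, forall b, sgn b <> Zero <-> olt b alpha }.

Definition is_restriction (x : No) (alpha : ord) (y : No) : Prop :=
  forall b, (olt b alpha -> y b = x b) /\ (~ olt b alpha -> y b = Zero).

(* [x alpha <> Zero] says that alpha is smaller than the domain of x. *)
Definition prec (y x : No) : Prop :=
  exists alpha, x alpha <> Zero /\ is_restriction x alpha y.

Definition preceq (y x : No) : Prop := prec y x \/ y = x.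

(* Lexicographic order, for - < undefined < +. *)
Definition No_lt (x y : No) : Prop :=
  exists b, (forall c, olt c b -> x c = y c) /\ sign_lt (x b) (y b).

Definition between (L R : set No) (z : No) : Prop :=
  (forall l, L l -> No_lt l z) /\ (forall r, R r -> No_lt z r).

(* z = {L | R}; in particular this includes L < R. *)
Definition is_cut (L R : set No) (z : No) : Prop :=
  between L R z /\ forall y, between L R y -> preceq z y.

Definition initial (S : set No) : Prop :=
  forall x y, S x -> preceq y x -> S y.

Definition vec (n : nat) := 'I_n -> No.

Definition func (n : nat) := vec n -> No.

(* A family of functions No^m -> No of varying arities m is a [set anyfunc]. *)
Definition anyfunc := {m : nat & func m}.

Definition closed_under (B : set anyfunc) (T : set No) : Prop :=
  forall g : anyfunc, B g ->
  forall v : vec (projT1 g), (forall i, T (v i)) -> T (projT2 g v).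

Definition cl (B : set anyfunc) (S : set No) : set No :=
  smallest (closed_under B) S.

Definition vpreceq n (y x : vec n) : Prop := forall i, preceq (y i) (x i).

Definition vprec n (y x : vec n) : Prop := vpreceq y x /\ y <> x.

Definition K (n : nat) := {s : 'I_n -> sign | s <> (fun=> Zero)}.

Definition is_option n (s : K n) (x y : vec n) : Prop :=
  vprec y x /\
  forall i, [/\ (No_lt (y i) (x i) <-> sval s i = Minus),
                (No_lt (x i) (y i) <-> sval s i = Plus)
              & (y i = x i <-> sval s i = Zero)].

(* The n + k n + k arguments available to an option: the coordinates of x, the
   coordinates of each x^s, and each f(x^s), where s ranges over K. *)
Inductive arg (n : nat) :=
  | Acur of 'I_n
  | Aopt of K n & 'I_n
  | Aval of K n.
Arguments Acur {n}.
Arguments Aopt {n}.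
Arguments Aval {n}.

(* An option is a function together with the arguments it is applied to.  As
   options may ignore arguments, not all of them have to occur; this matters,
   because an option that does not mention x^s must still contribute to the cut
   at those x which have no s-option at all. *)
Record opt (n : nat) := MkOpt {
  opt_arity : nat;
  opt_fun : func opt_arity;
  opt_arg : 'I_opt_arity -> arg n }.

Definition opt_in n (A : set anyfunc) (g : opt n) : Prop :=
  A (existT func (opt_arity g) (@opt_fun n g)).

Definition mentions n (g : opt n) (s : K n) : Prop :=
  exists j, opt_arg (o := g) j = Aval s \/
            exists i, opt_arg (o := g) j = Aopt s i.

Definition arg_value n (f : func n) (x : vec n) (xs : K n -> vec n) (a : arg n)
    : No :=
  match a with
  | Acur i => x i
  | Aopt s i => xs s i
  | Aval s => f (xs s)
  end.

(* All values at x of the options in G.  The choice of x^s is irrelevant, and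
   unconstrained, for the s that g does not mention. *)
Definition option_values n (f : func n) (G : set (opt n)) (x : vec n) : set No :=
  [set z | exists (g : opt n) (xs : K n -> vec n),
     [/\ G g,
         forall s, mentions g s -> is_option s x (xs s)
       & z = opt_fun (o := g) (fun j => arg_value f x xs (opt_arg (o := g) j))]].

Definition recursive_over (A : set anyfunc) n (f : func n) : Prop :=
  exists L R : set (opt n),
    [/\ is_small L, is_small R, L `<=` opt_in A, R `<=` opt_in A
      & forall x : vec n,
          is_cut (option_values f L x) (option_values f R x) (f x)].

(* Main.v *)
(* Let C be the closure of S under A and f, and let D be its largest initial
   subclass, i.e. the x all of whose initial segments lie in C.  The closure of
   D under A is initial and contained in C, so D is closed under A.  To see that
   D is closed under f, argue by induction on the argument x: all option values
   at x lie in D, and a proper initial segment y of f(x) = {L | R} is not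
   between L and R, so it is separated from f(x) by an option value z.  As the
   numbers extending y form a convex class, y is an initial segment of z, hence
   lies in D. *)
Require Import Defs.
From mathcomp Require Import all_boot boolp classical_sets.

Local Open Scope classical_set_scope.

Lemma ole_trans {a b c : ord} : ole a b -> ole b c -> ole a c.
Proof.
elim: a b c => I u IH [J v] [H w] /= uv vw i.
have [j uvij] := uv i; have [k vwjk] := vw j.
by exists k; apply: IH uvij vwjk.
Qed.

Lemma olt_ole_trans {a b c : ord} : olt a b -> ole b c -> olt a c.
Proof.
case: b c => [J v] [H w] /= [j avj] vw; have [k vwjk] := vw j.
by exists k; apply: ole_trans avj vwjk.
Qed.

Lemma ole_refl (a : ord) : ole a a.
Proof. by elim: a => I u IH /= i; exists i. Qed.

Lemma olt_ole {a b : ord} : olt a b -> ole a b.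
Proof.
elim: a b => I u IH [J v] [j uj] i; exists j; apply: IH.
by apply: olt_ole_trans _ uj; exists i; apply: ole_refl.
Qed.

Lemma ole_olt_trans {a b c : ord} : ole a b -> olt b c -> olt a c.
Proof. by case: c => [H w] ab [k bk]; exists k; apply: ole_trans ab bk. Qed.

Lemma ole_or_olt (a b : ord) : ole a b \/ olt b a.
Proof.
elim: a b => I u IH [J v].
have [?|nle] := pselect (ole (osup u) (osup v)); [by left|right].
have [i ni] : exists i, ~ exists j, ole (u i) (v j) by apply/existsNP.
(* [osup v] is at most [u i] exactly when every [v j] is strictly below [u i]; the induction
   hypothesis at [u i] gives this, as [u i] is at most no [v j]. *)
exists i => /=; case E : (u i) => [H w] j; rewrite -/(olt (v j) (osup w)) -E.
by case: (IH i (v j)) => // le_uv; case: ni; exists j.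
Qed.

Lemma No_eq (x y : No) : (forall b, x b = y b) -> x = y.
Proof.
case: x y => [u eu du] [v ev dv] /= uv.
have {}uv : u = v by apply/funext.
by subst v; congr MkNo; apply: Prop_irrelevance.
Qed.

Lemma sgn_neq0_ole (x : No) {a b : ord} : ole a b -> x b <> Zero -> x a <> Zero.
Proof.
have [d domx] := sgn_dom x => ab /domx bd; apply/domx.
exact: ole_olt_trans ab bd.
Qed.

Lemma restriction_neq0 {x y : No} {a b : ord} :
  is_restriction x a y -> y b <> Zero -> olt b a.
Proof.
by move=> xy yb; have [//|/(xy b).2] := pselect (olt b a).
Qed.

Lemma prec_trans {x y z : No} : prec z y -> prec y x -> prec z x.
Proof.
move=> [b [yb yz]] [a [xa xy]]; have ba := restriction_neq0 xy yb.
exists b; split; first by rewrite -(xy b).1.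
move=> c; split=> [cb|/(yz c).2 //].
by rewrite (yz c).1 // (xy c).1 //; apply: olt_ole_trans cb (olt_ole ba).
Qed.

Lemma preceq_trans {x y z : No} : preceq z y -> preceq y x -> preceq z x.
Proof.
case=> [zy|->//]; case=> [yx|<-]; last by left.
by left; apply: prec_trans zy yx.
Qed.

(** By induction on an ordinal bounding the domain of [x]: a proper initial segment is cut off at
    some [a] in that domain, so one of the branches of the bound already bounds it. The bound need
    not be exact, since such a branch may exceed [a]. *)
Lemma prec_wf : well_founded prec.
Proof.
suff acc (a : ord) (x : No) : (forall b, x b <> Zero -> olt b a) -> Acc prec x.
  by move=> x; have [a domx] := sgn_dom x; apply: (acc a) => b /domx.
elim: a x => I u IH x dom_x; constructor=> y [a [xa xy]].
have [i ai] := dom_x a xa; apply: (IH i) => b yb.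
exact: olt_ole_trans (restriction_neq0 xy yb) ai.
Qed.

Lemma prec_minimal (B : set No) :
  B !=set0 -> exists2 x, B x & forall y, B y -> ~ prec y x.
Proof.
move=> [x Bx]; apply: contrapT => nmin.
elim: (prec_wf x) Bx => {}x _ IH Bx; apply: nmin.
by exists x => // y By yx; apply: IH yx By.
Qed.

(* The coordinates are minimized one after the other. *)
Lemma vprec_minimal n (B : set (vec n)) :
  B !=set0 -> exists2 x, B x & forall y, B y -> ~ vprec y x.
Proof.
move=> B0.
suff /(_ n) [x Bx minx] : forall k, exists2 x, B x & forall y, B y ->
    vpreceq y x -> forall i : 'I_n, i < k -> y i = x i.
  exists x => // y By [yx]; apply; apply/funext => i.
  exact: minx By yx i (ltn_ord i).
elim=> [|k [x Bx minx]]; first by case: B0 => x Bx; exists x.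
have [kn|nk] := ltnP k n; last first.
  by exists x => // y By yx i _; apply: minx => //; apply: leq_trans nk.
pose i0 := Ordinal kn.
(* Only members of [B] below [x] compete at coordinate [i0], so the agreement on the earlier
   coordinates is kept; [x] itself shows that there are competitors. *)
have [_ [y [By yx] <-] miny] := @prec_minimal
  [set y i0 | y in [set y | B y /\ vpreceq y x]]
  (ex_intro _ (x i0) (ex_intro2 _ _ x (conj Bx (fun=> or_intror erefl)) erefl)).
exists y => // z Bz zy.
have zx : vpreceq z x by move=> i; apply: preceq_trans (zy i) (yx i).
move=> i; rewrite ltnS leq_eqVlt => /orP[/eqP ik|ik]; last first.
  by rewrite (minx z) // (minx y).
have -> : i = i0 by apply: val_inj.
by case: (zy i0) => // /miny; case; exists z.
Qed.

Lemma vprec_ind n (P : vec n -> Prop) :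
  (forall x, (forall y, vprec y x -> P y) -> P x) -> forall x, P x.
Proof.
move=> IH x; apply: contrapT => nPx.
have [|y nPy miny] := @vprec_minimal n [set y | ~ P y]; first by exists x.
by apply: nPy; apply: IH => z zy; apply: contrapT => /miny.
Qed.

(** Since [a] is at most [b], cutting [z] at [a] also yields [y]. If [a] is in the domain of [z],
    the segment is proper; otherwise [z] stops by [a] and equals [y]. *)
Lemma preceq_of_agree {x y z : No} {a b : ord} :
  x a <> Zero -> is_restriction x a y ->
  ~ olt b a -> (forall c, olt c b -> z c = x c) -> preceq y z.
Proof.
move=> xa xy nba zx.
have ab : ole a b by case: (ole_or_olt a b).
have zy : is_restriction z a y.
  move=> c; split=> [ca|/(xy c).2 //].
  by rewrite (xy c).1 // zx //; apply: olt_ole_trans ca ab.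
have [za|za] := pselect (z a = Zero); last by left; exists a.
right; apply: No_eq => c; have [/(zy c).1 //|nca] := pselect (olt c a).
rewrite (zy c).2 //; apply/esym; apply: contrapT => zc.
by case: (ole_or_olt a c) => [ac|//]; apply: (sgn_neq0_ole z ac zc za).
Qed.

(** If the first difference [b] of [z] and [x] came before the place [a] where [y] is cut off, [y]
    would agree with [x] up to and including [b], forcing [z] below [y]. *)
Lemma preceq_below (x y z : No) :
  prec y x -> No_lt z x -> ~ No_lt z y -> preceq y z.
Proof.
move=> [a [xa xy]] [b [zx ltb]] nzy; apply: (preceq_of_agree xa xy _ zx) => ba.
apply: nzy; exists b; rewrite (xy b).1 //; split=> // c cb.
by rewrite zx // (xy c).1 //; apply: olt_ole_trans cb (olt_ole ba).
Qed.

Lemma preceq_above (x y z : No) :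
  prec y x -> No_lt x z -> ~ No_lt y z -> preceq y z.
Proof.
move=> [a [xa xy]] [b [xz ltb]] nyz.
apply: (preceq_of_agree (b := b) xa xy) => [ba|c /xz //].
apply: nyz; exists b; rewrite (xy b).1 //; split=> // c cb.
by rewrite -xz // (xy c).1 //; apply: olt_ole_trans cb (olt_ole ba).
Qed.

Lemma prec_irrefl (x : No) : ~ prec x x.
Proof. by elim: (prec_wf x) => {}x _ IH xx; apply: IH (xx) (xx). Qed.

Lemma prec_cut (L R : set No) (x y : No) :
  is_cut L R x -> prec y x -> exists2 z, (L `|` R) z & preceq y z.
Proof.
move=> [[Lx xR] simplest] yx; apply: contrapT => nz.
(* A [y] between [L] and [R] would have the simplest element [x] as an initial segment, which is
   absurd for [y] properly shorter than [x]. *)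
suff /simplest [xy|xy] : between L R y.
- exact: prec_irrefl (prec_trans xy yx).
- by rewrite xy in yx; apply: prec_irrefl yx.
split=> z Sz; apply: contrapT => nlt; apply: nz; exists z.
- by left.
- exact: preceq_below yx (Lx z Sz) nlt.
- by right.
- exact: preceq_above yx (xR z Sz) nlt.
Qed.

Lemma sub_cl (B : set anyfunc) (S : set No) : S `<=` cl B S.
Proof. exact: sub_smallest. Qed.

Lemma cl_closed (B : set anyfunc) (S : set No) : closed_under B (cl B S).
Proof.
by move=> g Bg v Cv T [closedT ST]; apply: (closedT g Bg) => i; apply: (Cv i T).
Qed.

Lemma cl_sub (B : set anyfunc) (S T : set No) :
  closed_under B T -> S `<=` T -> cl B S `<=` T.
Proof. by move=> closedT ST x; apply; split. Qed.

Definition initial_core (C : set No) : set No :=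
  [set x | forall y, preceq y x -> C y].

Lemma initial_core_initial (C : set No) : initial (initial_core C).
Proof. by move=> x y Dx yx z zy; apply: Dx; apply: preceq_trans zy yx. Qed.

Lemma initial_core_sub (C : set No) : initial_core C `<=` C.
Proof. by move=> x; apply; right. Qed.

Lemma sub_initial_core (C T : set No) :
  initial T -> T `<=` C -> T `<=` initial_core C.
Proof. by move=> initT TC x Tx y yx; apply/TC/(initT x). Qed.

Lemma initial_core_closed (A : set anyfunc) (C : set No) :
  (forall T : set No, initial T -> initial (cl A T)) ->
  closed_under A C -> closed_under A (initial_core C).
Proof.
move=> hA closedC g Ag v Dv.
have clD : cl A (initial_core C) `<=` initial_core C.
  apply: sub_initial_core; first by apply: hA; apply: initial_core_initial.
  exact: cl_sub closedC (@initial_core_sub C).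
by apply: clD; apply: (cl_closed A _ g Ag) => i; apply: sub_cl.
Qed.

(** Coordinates of options of [x] lie in [T] because [T] is initial, and values of [f] there by the
    induction hypothesis on [f]; closure under [A] does the rest. One side [G] is treated at a time,
    so that [L] and [R] are both instances. *)
Lemma option_values_sub (A : set anyfunc) (T : set No) n (f : func n)
    (G : set (opt n)) (x : vec n) :
  closed_under A T -> initial T -> G `<=` opt_in A -> (forall i, T (x i)) ->
  (forall y, vprec y x -> (forall i, T (y i)) -> T (f y)) ->
  option_values f G x `<=` T.
Proof.
move=> closedT initT GA Tx IH _ [g [xs [Gg xsP ->]]].
apply: (closedT (existT func _ (@opt_fun n g)) (GA g Gg)) => /= j.
(* For other [s] the vector [xs s] is arbitrary and may leave [T]; each [Aopt] or [Aval] argument of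
   [g] is itself the required mention. *)
have Txs s : mentions g s -> vprec (xs s) x /\ forall i, T (xs s i).
  by move=> /xsP[xsx _]; split=> // i; apply: initT (Tx i) (xsx.1 i).
case E : (opt_arg (o := g) j) => [i|s i|s] /=; first exact: Tx.
- by have [|_] := Txs s; first by exists j; right; exists i.
- by have [|xsx Txss] := Txs s; [exists j; left | apply: IH].
Qed.

Theorem mainTheorem4 (A : set anyfunc)
    (hA : forall T : set No, initial T -> initial (cl A T))
    (n : nat) (f : func n) (hf : recursive_over A f)
    (S : set No) (hS : initial S) :
  initial (cl (A `|` [set existT func n f]) S).
Proof.
set B := A `|` _; set C := cl B S; pose D := initial_core C.
have closedC : closed_under B C by apply: cl_closed.
have initD : initial D by apply: initial_core_initial.
have DA : closed_under A D.
  by apply: initial_core_closed => // g Ag; apply: closedC; left.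
have Df x : (forall i, D (x i)) -> D (f x).
  case: hf => L [R [_ _ LA RA cutf]].
  (* Unfolding [D], each initial segment [y] of [f x] must be in [C]: for [f x] itself this is
     closure of [C] under [f], and only proper segments need the cut. *)
  elim/vprec_ind: x => x IH Dx y [yfx|->]; last first.
    apply: (closedC (existT func n f)); first by right.
    by move=> i; exact: initial_core_sub (Dx i).
  have [z LRz yz] := prec_cut _ _ _ _ (cutf x) yfx.
  suff Dz : D z by apply: Dz.
  by case: LRz; apply: (option_values_sub A).
(* Membership in [D] puts all initial segments in [C], so this inclusion is the initiality of [C];
   it follows from the minimality of [C]. *)
suff CD : C `<=` D by move=> x y /CD; apply.
apply: cl_sub; last by apply: sub_initial_core hS _; apply: sub_cl.
by move=> g [Ag|->]; [apply: DA | apply: Df].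
Qed.
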